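(* Let $k\geq 2$ and $1\leq i\leq k$ be integers. For integers $n,m\geq 0$, let $F_{k,i}(n,m)$ be the number of partitions $(p_1,\ldots,p_m)$, $p_1\geq p_2\geq\cdots\geq p_m$, of $n=\sum_l p_l$ into exactly $m$ positive parts such that $p_l\geq p_{l+k-1}+2$ for every $l$ with $l+k-1\leq m$, and $p_{m-i+1}\geq 2$ (whenever $m-i+1\geq 1$). Equivalently, these are the partitions of $n$ into $m$ parts whose frequencies satisfy $f_j+f_{j+1}\leq k-1$ for all $j\geq1$ and $f_1\leq i-1$, where $f_j$ is the number of parts equal to $j$. Let $G_{k,i}(n,m)$ be the number of ordered $(k-1)$-tuples of partitions $(n^{(1)},\ldots,n^{(k-1)})$, where $n^{(j)}=(n^{(j)}_1,\ldots,n^{(j)}_{m_j})$ has $m_j\geq 0$ parts, such that (a) $n^{(j)}_\ell\geq n^{(j)}_{\ell+1}+2j$ for all $1\leq \ell<m_j$; (b) if $m_j\geq 1$, then $n^{(j)}_{m_j}\geq j+\max(j-i+1,0)+2j(m_{j+1}+\cdots+m_{k-1})$; (c) $\sum_{j=1}^{k-1}\sum_{\ell=1}^{m_j} n^{(j)}_\ell=n$ and $\sum_{j=1}^{k-1} j\,m_j=m$. Then $F_{k,i}(n,m)=G_{k,i}(n,m)$ for all $n,m\geq 0$. *)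

(* Defs.v *)
From mathcomp Require Import all_boot zify.

Set Implicit Arguments.
Unset Strict Implicit.
Unset Printing Implicit Defensive.

Definition is_partition (p : seq nat) : bool :=
  sorted geq p && all (leq 1) p.

(* The parts p_1 >= ... >= p_m are nth 0 p 0, ..., nth 0 p m.-1, so that
   p_(m-i+1) is nth 0 p (m - i). *)
Definition F_partition (k i n m : nat) (p : seq nat) : bool :=
  [&& is_partition p, size p == m, sumn p == n,
      [forall l : 'I_(size p), (l + k.-1 < size p) ==>
         (nth 0 p (l + k.-1) + 2 <= nth 0 p l)]
    & (i <= size p) ==> (2 <= nth 0 p (size p - i))].

(* The component n^(j) (1 <= j <= k-1) of the tuple T. *)
Definition component (T : seq (seq nat)) (j : nat) : seq nat := nth [::] T j.-1.

(* In the lower bound on the last part, the truncated subtraction j.+1 - i is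
   max(j - i + 1, 0). *)
Definition G_tuple (k i n m : nat) (T : seq (seq nat)) : bool :=
  [&& size T == k.-1, all is_partition T,
      all (fun j => sorted (fun x y => y + 2 * j <= x) (component T j))
          (index_iota 1 k),
      all (fun j => (1 <= size (component T j)) ==>
             (j + (j.+1 - i) + 2 * j * \sum_(j.+1 <= r < k) size (component T r)
                <= last 0 (component T j)))
          (index_iota 1 k),
      \sum_(1 <= j < k) sumn (component T j) == n
    & \sum_(1 <= j < k) j * size (component T j) == m].

(* The bounds in the finite types below (parts at most n, at most m parts)
   exclude nothing: see F_count_spec and G_count_spec. *)
Definition F_embed (n m : nat) (p : m.-tuple 'I_n.+1) : seq nat :=
  [seq val x | x <- p].

Definition F_count (k i n m : nat) : nat :=
  #|[set p : m.-tuple 'I_n.+1 | F_partition k i n m (F_embed p)]|.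

Definition G_embed (k n m : nat) (T : k.-1.-tuple {bseq m of 'I_n.+1}) :
    seq (seq nat) :=
  [seq [seq val x | x <- bseqval s] | s <- T].

Definition G_count (k i n m : nat) : nat :=
  #|[set T : k.-1.-tuple {bseq m of 'I_n.+1} |
      G_tuple k i n m (G_embed T)]|.

Lemma card_embed (A : finType) (U : eqType) (e : A -> U) (P : pred U) :
  injective e -> (forall u, P u -> exists x, e x = u) ->
  exists s : seq U, [/\ uniq s, forall u, (u \in s) = P u
                      & size s = #|[set x | P (e x)]|].
Proof.
move=> inj_e surj_e; exists [seq e x | x <- enum [set x | P (e x)]].
split; [by rewrite map_inj_uniq ?enum_uniq| |by rewrite size_map -cardE].
move=> u; apply/mapP/idP => [[x]|Pu]; first by rewrite mem_enum inE => Px ->.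
by have [x ex] := surj_e u Pu; exists x; rewrite // mem_enum inE ex.
Qed.

Lemma leq_sumn_mem (x : nat) (s : seq nat) : x \in s -> x <= sumn s.
Proof.
elim: s => //= y s IHs; rewrite inE => /orP[/eqP->|/IHs]; first exact: leq_addr.
by move=> /leq_trans; apply; exact: leq_addl.
Qed.

Lemma map_inord (n : nat) (s : seq nat) :
  sumn s <= n -> [seq val x | x <- [seq inord x : 'I_n.+1 | x <- s]] = s.
Proof.
move=> le_n; rewrite -map_comp -[RHS]map_id; apply/eq_in_map => x xs /=.
by rewrite inordK // ltnS (leq_trans (leq_sumn_mem xs)).
Qed.

Lemma F_count_spec (k i n m : nat) :
  exists s : seq (seq nat),
    [/\ uniq s, forall p, (p \in s) = F_partition k i n m p
      & size s = F_count k i n m].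
Proof.
apply: card_embed => [p q /(inj_map val_inj)/val_inj //|p].
case/and5P=> _ /eqP size_p /eqP sum_p _ _.
have size_q : size [seq inord x : 'I_n.+1 | x <- p] == m.
  by rewrite size_map size_p.
by exists (Tuple size_q); rewrite /F_embed /= map_inord ?sum_p.
Qed.

Lemma G_count_spec (k i n m : nat) :
  exists s : seq (seq (seq nat)),
    [/\ uniq s, forall T, (T \in s) = G_tuple k i n m T
      & size s = G_count k i n m].
Proof.
apply: card_embed => [T1 T2 eqT|T].
  by apply/val_inj/(inj_map _ eqT) => x y /(inj_map val_inj)/val_inj.
case/and5P=> /eqP size_T _ _ _ /andP[/eqP sum_n /eqP sum_m].
have mem_T p : p \in T -> exists2 j, 1 <= j < k & p = component T j.
  move=> pT; exists (index p T).+1; last by rewrite /component nth_index.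
  by have := pT; rewrite -index_mem size_T; lia.
have sum_le (f : nat -> nat) j : 1 <= j < k -> f j <= \sum_(1 <= r < k) f r.
  move=> jk; rewrite (bigD1_seq j) ?iota_uniq ?mem_index_iota //=.
  exact: leq_addr.
have bT p : p \in T -> sumn p <= n /\ size p <= m.
  case/mem_T=> j jk ->; rewrite -sum_n -sum_m.
  split; first exact: (sum_le (fun r => sumn (component T r))).
  apply: leq_trans (sum_le (fun r => r * size (component T r)) j jk).
  by rewrite leq_pmull //; case/andP: jk.
pose enc p : {bseq m of 'I_n.+1} := insub_bseq m [seq inord x | x <- p].
have size_e : size [seq enc p | p <- T] == k.-1 by rewrite size_map size_T.
exists (Tuple size_e); rewrite /G_embed /= -map_comp -[RHS]map_id.
apply/eq_in_map => p /bT[le_n le_m] /=.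
rewrite /enc /insub_bseq val_insubd size_map le_m.
exact: map_inord.
Qed.

Lemma nth_geq_count (p : seq nat) (a l : nat) :
  sorted geq p -> 1 <= a -> (a <= nth 0 p l) = (l < count (leq a) p).
Proof.
move=> + a_gt0; elim: p l => [|x p IHp] l; first by rewrite nth_nil /=; lia.
move=> /= path_p; have sort_p := path_sorted path_p.
have [ax|xa] := leqP a x; first by case: l => [|l] //=; rewrite IHp //; lia.
suff p0 : count (leq a) p = 0 by case: l => [|l] /=; rewrite ?IHp ?p0 //; lia.
apply/eqP; rewrite -leqn0 leqNgt -has_count; apply/hasPn => y yp.
have geq_trans : transitive geq by move=> u v w /= ? ?; lia.
by have /allP/(_ y yp) /= := order_path_min geq_trans path_p; lia.
Qed.

(* The equivalent description by frequencies f_j = count_mem j p. *)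
Lemma F_partition_freq (k i n m : nat) (p : seq nat) :
  2 <= k -> 1 <= i <= k ->
  F_partition k i n m p <->
  [/\ is_partition p, size p = m, sumn p = n,
      forall j, 1 <= j -> count_mem j p + count_mem j.+1 p <= k - 1
    & count_mem 1 p <= i - 1].
Proof.
move=> hk hi.
have freq a : count (leq a) p = count_mem a p + count (leq a.+1) p.
  by elim: p => //= x p ->; lia.
have size_nth l : 1 <= nth 0 p l -> l < size p.
  by move=> h; rewrite ltnNge; apply/negP => /(nth_default 0) h0; lia.
have sizeE : is_partition p -> size p = count (leq 1) p.
  by case/andP=> _; rewrite all_count => /eqP.
split=> [/and5P[pp /eqP sp /eqP np /forallP gap low]|[pp sp np gap low]].
  have [/andP[sorted_p _] size_p] := (pp, sizeE pp).
  split=> // [j j_gt0|].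
    have := freq j; have := freq j.+1; set c := count (leq j.+2) p => f2 f1.
    rewrite leqNgt; apply/negP => lt_k.
    have cj : j <= nth 0 p (c + k.-1) by rewrite nth_geq_count //; lia.
    have c2 : nth 0 p c <= j.+1 by rewrite leqNgt nth_geq_count // ltnn.
    have ltc : c + k.-1 < size p by apply: size_nth; lia.
    have cp : c < size p by lia.
    by have /= := gap (Ordinal cp); rewrite ltc /=; lia.
  have := freq 1; rewrite -size_p => f1.
  have [le_i|] := leqP i (size p); last by lia.
  move: low; rewrite le_i /= nth_geq_count //.
  by move: f1 le_i; set f := count_mem _ _; set c := count _ _ => f1 le_i; lia.
have [/andP[sorted_p pos_p] size_p] := (pp, sizeE pp).
apply/and5P; split=> //; try exact/eqP.
  apply/forallP=> l; apply/implyP=> lt_l.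
  set j := nth 0 p (l + k.-1).
  have j_gt0 : 1 <= j by exact: (allP pos_p _ (mem_nth 0 lt_l)).
  have : l + k.-1 < count (leq j) p by rewrite -nth_geq_count.
  rewrite nth_geq_count; [|by []|by lia].
  by have := gap j j_gt0; have := freq j; have := freq j.+1; rewrite addn2; lia.
apply/implyP=> le_i; rewrite nth_geq_count //.
by have := freq 1; rewrite -size_p; lia.
Qed.

(* Main.v *)
Require Import Defs.
From mathcomp Require Import all_boot.
From mathcomp Require Import zify.

Set Implicit Arguments.
Unset Strict Implicit.
Unset Printing Implicit Defensive.

(* Replace the terms [max(j - i + 1, 0)] of condition (b) by an arbitrary shift
   [a_j], and let [S_a(x, q)] be the generating function of the resulting tuples,
   so that [G_(k,i)] belongs to [a_j = j - min(j, i - 1)].  Discarding the last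
   part of [n^(j)] when it is as small as allowed gives
     [S_a = S_(a + e_j) + x^j q^(j + a_j) S_(a + 2 min(j, .))].
   A telescoping combination of these relations (see [Phi]) yields the
   Rogers-Selberg recursion
     [J_(k,i+1)(x) - J_(k,i)(x) = (x q)^i J_(k,k-i)(x q)],
   which [F] satisfies too: a partition with exactly [i] ones loses them, and the
   remaining parts decrease by one.  The recursion determines [J]. *)

(** * Counting through duplicate-free lists, and bijections *)

(** A relation on arbitrary sequences, so that bijections need not respect the finite types, whose
    bounds change with [n] and [m]. *)
Definition counts (U : eqType) (P : pred U) (c : nat) : Prop :=
  exists s : seq U, [/\ uniq s, forall u, (u \in s) = P u & size s = c].

Lemma counts_filter (U : eqType) (P Q : pred U) (c : nat) :
  counts P c ->
  exists2 d, counts (predI P Q) d & counts (predD P Q) (c - d) /\ d <= c.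
Proof.
case=> s [us sP <-]; exists (count Q s).
  exists [seq x <- s | Q x]; split; rewrite ?filter_uniq ?size_filter //.
  by move=> u; rewrite mem_filter sP /= andbC.
split; last exact: count_size.
exists [seq x <- s | predC Q x]; split; rewrite ?filter_uniq ?size_filter //.
  by move=> u; rewrite mem_filter sP.
by rewrite -(count_predC Q s) addKn.
Qed.

(** [f] and [g] are total but mutually inverse only on relevant arguments. [L] describes the
    matching pairs, so one equivalence [P u = Q v] serves both directions. *)
Lemma counts_bij (U V : eqType) (P : pred U) (Q : pred V) (L : U -> V -> Prop)
    (f : U -> V) (g : V -> U) (c d : nat) :
  (forall u, P u -> L u (f u)) -> (forall v, Q v -> L (g v) v) ->
  (forall u v, L u v -> [/\ P u = Q v, f u = v & g v = u]) ->
  counts P c -> counts Q d -> c = d.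
Proof.
move=> Lf Lg L_bij [s [us sP <-]] [t [ut tQ <-]].
have fK u : P u -> g (f u) = u by move=> /Lf /L_bij[].
rewrite -(size_map f s); apply/perm_size/uniq_perm => //.
  rewrite map_inj_in_uniq // => u v; rewrite !sP => Pu Pv fuv.
  by rewrite -(fK u Pu) fuv fK.
move=> v; rewrite tQ; apply/mapP/idP => [[u]|Qv].
  by rewrite sP => Pu ->; case: (L_bij _ _ (Lf u Pu)) => <-.
have [PQ fgv _] := L_bij _ _ (Lg v Qv).
by exists (g v); rewrite ?sP ?PQ.
Qed.

Lemma counts_unique (U : eqType) (P : pred U) (c d : nat) :
  counts P c -> counts P d -> c = d.
Proof. by apply: (counts_bij (L := eq) (f := id) (g := id)) => // u v ->. Qed.

Lemma counts_split_bij (U V : eqType) (P Q : pred U) (R : pred V)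
    (L : U -> V -> Prop) (f : U -> V) (g : V -> U) (c d e : nat) :
  (forall u, Q u -> P u) ->
  (forall u, predD P Q u -> L u (f u)) -> (forall v, R v -> L (g v) v) ->
  (forall u v, L u v -> [/\ predD P Q u = R v, f u = v & g v = u]) ->
  counts P c -> counts Q d -> counts R e -> c = d + e.
Proof.
move=> QP Lf Lg L_bij cP cQ cR.
have [d' cPQ [cPD le_d]] := counts_filter Q cP.
have -> : d = d'.
  apply: counts_unique cQ _; case: cPQ => s [us sP sd]; exists s; split=> // u.
  by rewrite sP /= andb_idl //; exact: QP.
have <- := counts_bij Lf Lg L_bij cPD cR.
by rewrite subnKC.
Qed.

Lemma F_partition0 (k n m : nat) (p : seq nat) : F_partition k 0 n m p = false.
Proof.
by rewrite /F_partition subn0 nth_default //= !andbF.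
Qed.

Lemma counts_F (k i n m : nat) : counts (F_partition k i n m) (F_count k i n m).
Proof. exact: F_count_spec. Qed.

(** In a decreasing sequence of positive parts, nothing but ones can follow a one. *)
Lemma partition_split_ones (p : seq nat) :
  is_partition p -> p = [seq x <- p | 2 <= x] ++ nseq (count_mem 1 p) 1.
Proof.
elim: p => //= x p IHp; rewrite /is_partition /=.
case/andP=> path_p /andP[x_gt0 pos_p]; have [x_gt1|] := ltnP 1 x.
  rewrite eqn_leq (leqNgt x) x_gt1 /= add0n -IHp //.
  by rewrite /is_partition pos_p (path_sorted path_p).
move=> x_le1; have x1 : x = 1 by lia.
rewrite {}x1 in path_p *.
have geq_trans : transitive geq by move=> u v w /= ? ?; lia.
have /all_pred1P -> : all (pred1 1) p.
  apply/allP=> y yp /=; have := allP (order_path_min geq_trans path_p) y yp.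
  by have := allP pos_p y yp => /=; lia.
by rewrite filter_nseq count_nseq /= mul1n.
Qed.

Lemma F_partition_exact (k i n m : nat) (p : seq nat) :
  2 <= k -> i < k ->
  predD (F_partition k i.+1 n m) (F_partition k i n m) p <->
  [/\ is_partition p, size p = m, sumn p = n,
      forall j, 1 <= j -> count_mem j p + count_mem j.+1 p <= k - 1
    & count_mem 1 p = i].
Proof.
move=> hk hi; have hi1 : 1 <= i.+1 <= k by [].
split=> [/andP[nF /F_partition_freq-/(_ hk hi1)[p1 p2 p3 p4 p5]]|[p1 p2 p3 p4 p5]].
  split=> //; apply/eqP; rewrite eqn_leq; apply/andP; split; first by lia.
  case: i hi nF {hi1 p5} => // i hi /negP nF; rewrite ltnNge.
  by apply/negP=> le_i; apply: nF; apply/F_partition_freq => //; [lia|split=> //; lia].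
apply/andP; split; last by apply/F_partition_freq => //; split=> //; lia.
case: i hi hi1 p5 => [|i] hi hi1 p5; first by rewrite F_partition0.
by apply/negP=> /F_partition_freq-/(_ hk)[]; lia.
Qed.

(* Subtract 1 from every part and drop the [i] ones. *)
Lemma F_count_rec (k i n m : nat) :
  2 <= k -> i < k ->
  F_count k i.+1 n m =
  F_count k i n m +
  if (m <= n) && (i <= m) then F_count k (k - i) (n - m) (m - i) else 0.
Proof.
move=> hk hi.
(* The guards keep the subtractions [n - m] and [m - i] from truncating. *)
pose R q := [&& m <= n, i <= m & F_partition k (k - i) (n - m) (m - i) q].
pose g q := [seq x.+1 | x <- q] ++ nseq i 1.
pose f p := [seq x.-1 | x <- p & 2 <= x].
(* Positivity of [q] makes the raised parts at least [2], so they stay distinct from the [i]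
   appended ones. *)
pose L p q := all (leq 1) q /\ p = g q.
have hki : 1 <= k - i <= k by lia.
apply: (@counts_split_bij _ _ (F_partition k i.+1 n m) (F_partition k i n m) R
  L f g); try exact: counts_F.
- move=> p; case: i hi {R g f L hki} => [|i] hi; first by rewrite F_partition0.
  move=> /F_partition_freq[]; try lia.
  by move=> p1 p2 p3 p4 p5; apply/F_partition_freq => //; split=> //; lia.
- move=> p /F_partition_exact-/(_ hk hi)[p1 p2 p3 p4 p5]; split.
    apply/allP=> x /mapP[y]; rewrite mem_filter => /andP[y_gt1 _] ->.
    by lia.
  rewrite {1}(partition_split_ones p1) p5 /g /f -map_comp.
  congr (_ ++ _); rewrite -[LHS]map_id; apply/eq_in_map => x.
  by rewrite mem_filter => /andP[] /=; lia.
- move=> q /and3P[_ _ /F_partition_freq-/(_ hk hki)[q1 _ _ _ _]].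
  by split=> //; case/andP: q1.
- move=> /= p q [pos_q ->]; split=> //.
    have cS j : 1 <= j -> count_mem j.+1 (g q) = count_mem j q.
      move=> j_gt0; rewrite count_cat count_nseq count_map /=.
      by rewrite (_ : 1 == j.+1 = false) ?addn0; last lia.
    have c1 : count_mem 1 (g q) = i.
      rewrite count_cat count_nseq count_map /= mul1n.
      rewrite (_ : count _ q = 0) //; apply/eqP.
      rewrite -leqn0 leqNgt -has_count; apply/hasPn => y /(allP pos_q) /=.
      by lia.
    have geq_trans : transitive geq by move=> u v w /= ? ?; lia.
    have gP : is_partition (g q) = is_partition q.
      rewrite /is_partition pos_q !sorted_pairwise //.
      rewrite pairwise_cat pairwise_map all_cat all_map all_nseq.
      rewrite (_ : allrel _ _ _); last first.
        by apply/allrelP => x y /mapP[z _ ->] /nseqP[-> _].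
      rewrite (_ : pairwise _ (nseq _ _)) /= ?andbT; last first.
        by elim: (i) => //= d ->; rewrite all_nseq orbT.
      by rewrite (_ : all _ q) ?orbT ?andbT //; apply/allP.
    have sz : size (g q) = size q + i by rewrite size_cat size_map size_nseq.
    have sm : sumn (g q) = sumn q + size q + i.
      rewrite sumn_cat sumn_nseq mul1n; congr (_ + i).
      by elim: (q) => //= x r ->; lia.
    apply/idP/idP.
      move=> /F_partition_exact-/(_ hk hi)[].
      rewrite gP sz sm c1 => q1 q2 q3 q4 _; apply/and3P; split; [lia|lia|].
      apply/F_partition_freq => //; split=> //; [lia|lia| |].
        by move=> j j_gt0; have := q4 j.+1; rewrite !cS //; apply.
      (* The ones of [q] are the twos of [g q]: from [f_1 + f_2 <= k - 1] and [f_1 = i] their number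
         is at most [(k - i) - 1]. *)
      by have := q4 1 isT; rewrite c1 cS //; lia.
    case/and3P=> mn im /F_partition_freq-/(_ hk hki)[q1 q2 q3 q4 q5].
    apply/F_partition_exact => //; split; rewrite ?gP ?sz ?sm //; [lia|lia|].
    case=> [//|[|j]] _; last by rewrite !cS //; exact: q4.
    by rewrite c1 cS //; lia.
  rewrite /f /g filter_cat filter_nseq cats0 filter_map.
  rewrite -map_comp (_ : [seq x <- q | _] = q) ?map_id //.
  exact/all_filterP.
- case: ifP => [/andP[mn im]|mn]; first by rewrite /R mn im; exact: counts_F.
  by exists [::]; split=> // q; rewrite in_nil /R andbA mn.
Qed.

(** * Sequences with prescribed gaps and a lower bound *)

Definition gap_above (d c : nat) (s : seq nat) : bool :=
  sorted (fun x y => y + d <= x) s && ((1 <= size s) ==> (c <= last 0 s)).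

(** Peeling off the smallest part [x] leaves a condition of the same kind with bound [x + d]; this
    drives the inductions from the right end. *)
Lemma gap_above_rcons (d c : nat) (s : seq nat) (x : nat) :
  gap_above d c (rcons s x) = (c <= x) && gap_above d (x + d) s.
Proof.
rewrite /gap_above last_rcons size_rcons /= andbC; congr (_ && _).
by case: s => //= y s; rewrite rcons_path.
Qed.

Lemma gap_above_map (d c e : nat) (s : seq nat) :
  gap_above d (c + e) [seq x + e | x <- s] = gap_above d c s.
Proof.
elim/last_ind: s c => [|s x IHs] c //.
by rewrite map_rcons !gap_above_rcons leq_add2r addnAC IHs.
Qed.

Lemma gap_above_ge (d c : nat) (s : seq nat) : gap_above d c s -> all (leq c) s.
Proof.
elim/last_ind: s c => [|s x IHs] c //.
rewrite gap_above_rcons all_rcons => /andP[cx /IHs /allP sx]; rewrite /= cx /=.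
by apply/allP=> y /sx; lia.
Qed.

Lemma gap_above_partition (d c : nat) (s : seq nat) :
  1 <= c -> gap_above d c s -> is_partition s.
Proof.
move=> c_gt0 gs; apply/andP; split.
  case/andP: gs => + _; case: s => //= x s.
  by apply: sub_path => y z /=; lia.
by apply: sub_all (gap_above_ge gs) => x /=; lia.
Qed.

Lemma gap_above_mono (d c c' : nat) (s : seq nat) :
  c' <= c -> gap_above d c s -> gap_above d c' s.
Proof. by rewrite /gap_above => le_c /andP[-> /=]; case: s => //= x s; lia. Qed.

(** The empty sequence meets every bound, so failure at [c.+1] forces a last part, and this part
    equals [c]. *)
Lemma gap_above_tight (d c : nat) (s : seq nat) :
  gap_above d c s -> ~~ gap_above d c.+1 s ->
  s = rcons (take (size s).-1 s) c.
Proof.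
elim/last_ind: s => [//|s x _].
rewrite !gap_above_rcons size_rcons /= -cats1 take_size_cat // cats1.
move=> /andP[cx ->]; rewrite andbT -leqNgt => xc.
by congr rcons; lia.
Qed.

(** * Tuples with an arbitrary shift, and their number *)

Definition shifted_tuple (k : nat) (a : nat -> nat) (n m : nat)
    (T : seq (seq nat)) : bool :=
  [&& size T == k.-1,
      all (fun j => gap_above (2 * j)
             (j + a j + 2 * j * \sum_(j.+1 <= r < k) size (component T r))
             (component T j))
          (index_iota 1 k),
      \sum_(1 <= j < k) sumn (component T j) == n
    & \sum_(1 <= j < k) j * size (component T j) == m].

Lemma shifted_tupleP (k : nat) (a : nat -> nat) (n m : nat) (T : seq (seq nat)) :
  reflect
    [/\ size T = k.-1,
        forall j, 1 <= j < k -> gap_above (2 * j)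
          (j + a j + 2 * j * \sum_(j.+1 <= r < k) size (component T r))
          (component T j),
        \sum_(1 <= j < k) sumn (component T j) = n
      & \sum_(1 <= j < k) j * size (component T j) = m]
    (shifted_tuple k a n m T).
Proof.
apply: (iffP and4P) => [[/eqP-> /allP gapT /eqP-> /eqP->]|[-> gapT -> ->]].
  by split=> // j jk; apply: gapT; rewrite mem_index_iota.
split=> //; apply/allP => j; rewrite mem_index_iota; exact: gapT.
Qed.

Lemma G_tupleE (k i n m : nat) :
  G_tuple k i n m =1 shifted_tuple k (fun j => j.+1 - i) n m.
Proof.
move=> T; apply/idP/shifted_tupleP.
  case/and5P=> /eqP-> _ /allP sT /allP lT /andP[/eqP-> /eqP->].
  split=> // j jk; rewrite -mem_index_iota in jk.
  by apply/andP; split; [exact: sT | exact: lT].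
case=> szT gapT nT mT; rewrite /G_tuple szT nT mT !eqxx /= andbT.
apply/and3P; split; [apply/allP => s sT | apply/allP => j | apply/allP => j];
  rewrite ?mem_index_iota; try by move=> /gapT/andP[].
(* The lower bound of a component is at least its index, hence positive, and [gap_above] then gives
   a partition. *)
have jk : 1 <= (index s T).+1 < k by move: sT; rewrite -index_mem szT; lia.
have := gapT _ jk; rewrite /component nth_index //.
by apply: gap_above_partition; lia.
Qed.

Lemma shifted_tuple_mono (k : nat) (a b : nat -> nat) (n m : nat)
    (T : seq (seq nat)) :
  (forall j, 1 <= j < k -> a j <= b j) ->
  shifted_tuple k b n m T -> shifted_tuple k a n m T.
Proof.
move=> ab /shifted_tupleP[? gapT ? ?]; apply/shifted_tupleP; split=> // j jk.
by apply: gap_above_mono (gapT j jk); have := ab j jk; lia.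
Qed.

Lemma eq_shifted_tuple (k : nat) (a b : nat -> nat) (n m : nat) :
  (forall j, 1 <= j < k -> a j = b j) ->
  shifted_tuple k a n m =1 shifted_tuple k b n m.
Proof.
move=> ab T; apply/idP/idP; apply: shifted_tuple_mono => j jk.
  by rewrite ab.
by rewrite ab.
Qed.

Definition shifted_count (k : nat) (a : nat -> nat) (n m : nat) : nat :=
  #|[set T : k.-1.-tuple {bseq m of 'I_n.+1} |
      shifted_tuple k a n m (G_embed T)]|.

Lemma eq_shifted_count (k : nat) (a b : nat -> nat) (n m : nat) :
  (forall j, 1 <= j < k -> a j = b j) ->
  shifted_count k a n m = shifted_count k b n m.
Proof.
by move=> ab; apply: eq_card => T; rewrite !inE (eq_shifted_tuple _ _ ab).
Qed.

Lemma G_countE (k i n m : nat) :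
  G_count k i n m = shifted_count k (fun j => j.+1 - i) n m.
Proof. by apply: eq_card => T; rewrite !inE G_tupleE. Qed.

Lemma G_embed_inj (k n m : nat) : injective (@G_embed k n m).
Proof.
move=> T1 T2 eqT.
by apply/val_inj/(inj_map _ eqT) => x y /(inj_map val_inj)/val_inj.
Qed.

(** The point is that the embedding reaches every shifted tuple. Lowering the shift to [0], which is
    the case [i = k] of [G], puts [T] in the list of [G_count_spec]; the embedded tuples form a
    sublist of the same size, hence fill that list. *)
Lemma counts_shifted (k : nat) (a : nat -> nat) (n m : nat) :
  counts (shifted_tuple k a n m) (shifted_count k a n m).
Proof.
apply: card_embed (@G_embed_inj k n m) _ => T.
move/(@shifted_tuple_mono _ (fun j => j.+1 - k) _ _ _ _ _).
rewrite -G_tupleE => GT.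
have [s [us sG sz]] := G_count_spec k k n m.
pose t := [seq G_embed x | x in [set x | G_tuple k k n m (@G_embed k n m x)]].
have ut : uniq t.
  by rewrite map_inj_uniq ?enum_uniq //; exact: G_embed_inj.
have ts : {subset t <= s}.
  by move=> u /imageP[x]; rewrite inE sG => Gx ->.
have [] := uniq_min_size ut ts; first by rewrite size_image sz.
move=> _ /(_ T); rewrite sG GT; last by move=> j jk; lia.
by case/imageP=> x _ ->; exists x.
Qed.

(** * Translating the components and removing a tight last part *)

Definition map_components (k : nat) (f : nat -> seq nat -> seq nat)
    (T : seq (seq nat)) : seq (seq nat) :=
  mkseq (fun r => f r.+1 (component T r.+1)) k.-1.

Lemma component_map (k : nat) (f : nat -> seq nat -> seq nat)
    (T : seq (seq nat)) (j : nat) :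
  1 <= j < k -> component (map_components k f T) j = f j (component T j).
Proof.
by case: j => // j jk; rewrite /component nth_mkseq //=; lia.
Qed.

Lemma eq_components (k : nat) (T T' : seq (seq nat)) :
  size T = k.-1 -> size T' = k.-1 ->
  (forall j, 1 <= j < k -> component T j = component T' j) -> T = T'.
Proof.
move=> sT sT' eqT; apply: (@eq_from_nth _ [::]); first by rewrite sT.
by move=> j; rewrite sT => jk; apply: (eqT j.+1); lia.
Qed.

(* Subtract [j] from every part of the [j]-th component. *)
Lemma shifted_count_translate (k : nat) (a : nat -> nat) (n m : nat) :
  shifted_count k (fun j => a j + j) n m =
  if m <= n then shifted_count k a (n - m) m else 0.
Proof.
pose R T := (m <= n) && shifted_tuple k a (n - m) m T.
pose f := map_components k (fun j s => [seq x - j | x <- s]).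
pose g := map_components k (fun j s => [seq x + j | x <- s]).
pose L T T' := [/\ size T = k.-1, size T' = k.-1 &
  forall j, 1 <= j < k -> component T j = [seq x + j | x <- component T' j]].
apply: (@counts_bij _ _ (shifted_tuple k (fun j => a j + j) n m) R L f g).
- move=> /= T /shifted_tupleP[sT gapT _ _]; split; rewrite ?size_mkseq // => j jk.
  rewrite component_map // -map_comp -[LHS]map_id; apply/eq_in_map => x xT /=.
  by have /allP/(_ x xT) := gap_above_ge (gapT j jk); lia.
- move=> /= T /andP[_ /shifted_tupleP[sT gapT _ _]].
  by split; rewrite ?size_mkseq // => j jk; rewrite component_map.
- move=> /= T T' [sT sT' eqT]; split; last 2 first.
  + apply: (@eq_components k); rewrite ?size_mkseq // => j jk.
    rewrite component_map // eqT // -map_comp -[RHS]map_id.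
    by apply: eq_map => x /=; lia.
  + apply: (@eq_components k); rewrite ?size_mkseq // => j jk.
    by rewrite component_map // eqT.
  have eq_size j : 1 <= j < k -> size (component T j) = size (component T' j).
    by move=> jk; rewrite eqT // size_map.
  (* Adding [j] to each of the [m_j] parts costs [j * m_j], in total [m]. *)
  have sumE : \sum_(1 <= j < k) sumn (component T j) =
      \sum_(1 <= j < k) sumn (component T' j)
      + \sum_(1 <= j < k) j * size (component T' j).
    rewrite -big_split; apply: eq_big_nat => j jk; rewrite eqT //=.
    by elim: (component T' j) => [|x s /= ->] /=; lia.
  have sizeE : \sum_(1 <= j < k) j * size (component T j) =
      \sum_(1 <= j < k) j * size (component T' j).
    by apply: eq_big_nat => j jk; rewrite eq_size.
  have gapE j : 1 <= j < k -> gap_above (2 * j)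
      (j + (a j + j) + 2 * j * \sum_(j.+1 <= r < k) size (component T r))
      (component T j) = gap_above (2 * j)
      (j + a j + 2 * j * \sum_(j.+1 <= r < k) size (component T' r))
      (component T' j).
    move=> jk; rewrite eqT // -[RHS](gap_above_map _ _ j).
    congr gap_above.
    rewrite (@eq_big_nat _ _ _ j.+1 k _ (fun r => size (component T' r))); first by lia.
    by move=> r rk; rewrite eq_size //; lia.
  apply/shifted_tupleP/andP.
    case=> _ gapT nT mT; split; first by lia.
    apply/shifted_tupleP; split=> //; try lia.
    by move=> j jk; rewrite -gapE // gapT.
  case=> mn /shifted_tupleP[_ gapT nT mT]; split=> //; try lia.
  by move=> j jk; rewrite gapE // gapT.
- exact: counts_shifted.
- case: ifP => mn; first by rewrite /R mn; exact: counts_shifted.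
  by exists [::]; split=> // T; rewrite in_nil /R mn.
Qed.

(* Remove the last part of the [j]-th component when it is as small as allowed,
   and compensate for its weight by adding [2 * j] to every part of the
   components [r > j]. *)
Lemma shifted_count_rec (k : nat) (a : nat -> nat) (j n m : nat) :
  1 <= j < k ->
  shifted_count k a n m =
  shifted_count k (fun r => a r + (r == j)) n m +
  if (j + a j <= n) && (j <= m)
  then shifted_count k (fun r => a r + 2 * minn r j) (n - (j + a j)) (m - j)
  else 0.
Proof.
move=> jk.
pose above T := \sum_(j.+1 <= r < k) size (component T r).
pose R T := [&& j + a j <= n, j <= m &
  shifted_tuple k (fun r => a r + 2 * minn r j) (n - (j + a j)) (m - j) T].
pose f := map_components k (fun r s =>
  if r < j then s else if r == j then take (size s).-1 s
  else [seq x + 2 * j | x <- s]).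
(* The appended part is the least one that the bound on the [j]-th component allows. *)
pose g T := map_components k (fun r s =>
  if r < j then s else if r == j then rcons s (j + a j + 2 * j * above T)
  else [seq x - 2 * j | x <- s]) T.
pose L T T' := [/\ size T = k.-1, size T' = k.-1,
  forall r, 1 <= r < j -> component T r = component T' r,
  component T j = rcons (component T' j) (j + a j + 2 * j * above T') &
  forall r, j < r < k -> component T' r = [seq x + 2 * j | x <- component T r]].
apply: (@counts_split_bij _ _ (shifted_tuple k a n m)
  (shifted_tuple k (fun r => a r + (r == j)) n m) R L f g).
- by move=> T; apply: shifted_tuple_mono => r _; lia.
- move=> /= T /andP[nT PT].
  have /shifted_tupleP[sT gapT nsum msum] := PT.
  have szf r : j < r < k -> component (f T) r = [seq x + 2 * j | x <- component T r].
    move=> rk; rewrite component_map; last by lia.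
    by rewrite ltnNge (ltnW (proj1 (andP rk))) /= gtn_eqF //; lia.
  split; rewrite ?size_mkseq //.
  + by move=> r rj; rewrite component_map; [case/andP: rj => _ ->|lia].
  (* The shifts [a] and [a + e_j] differ only in the bound on the [j]-th component, so its last part
     must be tight. *)
  + rewrite component_map // ltnn eqxx; apply: (@gap_above_tight (2 * j)).
      rewrite /above (@eq_big_nat _ _ _ _ _ _ (fun r => size (component T r))).
        exact: gapT.
      by move=> r rk; rewrite szf // size_map.
    apply: contra nT => gj; apply/shifted_tupleP; split=> // r rk.
    have [->|_] := eqVneq r j; last by rewrite addn0; exact: gapT.
    move: gj; rewrite /above.
    rewrite (@eq_big_nat _ _ _ _ _ _ (fun r => size (component T r))).
      by rewrite addn1 addnS addSn.
    by move=> t tk; rewrite szf // size_map.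
- move=> /= T /and3P[_ _ /shifted_tupleP[sT gapT _ _]].
  split; rewrite ?size_mkseq //.
  + by move=> r rj; rewrite component_map; [case/andP: rj => _ ->|lia].
  + by rewrite component_map // ltnn eqxx.
  + move=> r rk; rewrite component_map; last by lia.
    rewrite ltnNge (ltnW (proj1 (andP rk))) /= gtn_eqF; last by lia.
    have /gapT/gap_above_ge/allP gr : 1 <= r < k by lia.
    rewrite -map_comp -[LHS]map_id; apply/eq_in_map => x /gr /=.
    by rewrite (minn_idPr _); lia.
- move=> /= T T' [sT sT' eq_lt eq_j eq_gt].
  have szE r : 1 <= r < k ->
      size (component T r) = size (component T' r) + (r == j).
    move=> rk; have [rj|rj|->] := ltngtP r j.
    + by rewrite eq_lt ?addn0 //; lia.
    + by rewrite eq_gt ?size_map ?addn0 //; lia.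
    + by rewrite eq_j size_rcons addn1.
  have aboveE : above T = above T'.
    by apply: eq_big_nat => r rk; rewrite szE ?gtn_eqF ?addn0 //; lia.
  split; last 2 first.
  + apply: (@eq_components k); rewrite ?size_mkseq // => r rk.
    rewrite component_map //; have [rj|rj|->] := ltngtP r j.
    * by rewrite eq_lt //; lia.
    * by rewrite -eq_gt //; lia.
    * by rewrite eq_j size_rcons /= -cats1 take_size_cat.
  + apply: (@eq_components k); rewrite ?size_mkseq // => r rk.
    rewrite component_map //; have [rj|rj|->] := ltngtP r j.
    * by rewrite eq_lt //; lia.
    * rewrite eq_gt; last by lia.
      by rewrite -map_comp -[RHS]map_id; apply: eq_map => x /=; lia.
    * by rewrite eq_j.
  have sum_split (h : nat -> nat) : \sum_(1 <= r < k) h r =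
      \sum_(1 <= r < j) h r + (h j + \sum_(j.+1 <= r < k) h r).
    rewrite (@big_cat_nat _ _ _ j) //=; try lia.
    by rewrite [X in _ + X]big_ltn //; lia.
  (* The portion [2 * j * above T'] of the removed part goes to the components [r > j], whose parts
     each gain [2 * j]; the net loss is [j + a j]. *)
  have sumE : \sum_(1 <= r < k) sumn (component T r) =
      \sum_(1 <= r < k) sumn (component T' r) + (j + a j).
    rewrite !sum_split eq_j sumn_rcons.
    rewrite (@eq_big_nat _ _ _ 1 j _ (fun r => sumn (component T' r))); last first.
      by move=> r rj; rewrite eq_lt.
    rewrite (@eq_big_nat _ _ _ j.+1 k (fun r => sumn (component T' r))
      (fun r => sumn (component T r) + 2 * j * size (component T' r))).
      by rewrite big_split /= -big_distrr /= -/(above T'); lia.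
    move=> r rk; rewrite eq_gt // size_map.
    by elim: (component T r) => [|x s /=] /=; lia.
  have sizeE : \sum_(1 <= r < k) r * size (component T r) =
      \sum_(1 <= r < k) r * size (component T' r) + j.
    rewrite !sum_split szE // eqxx.
    rewrite (@eq_big_nat _ _ _ 1 j _ (fun r => r * size (component T' r))); last first.
      by move=> r rj; rewrite eq_lt.
    rewrite (@eq_big_nat _ _ _ j.+1 k _ (fun r => r * size (component T' r))).
      by lia.
    by move=> r rk; rewrite eq_gt // size_map.
  (* For [r < j] the bound loses [2 * r] because the [j]-th component is one part shorter, and the
     new shift restores it; for [r > j] bound and parts both rise by [2 * j]. *)
  have gapE r : 1 <= r < k -> r != j -> gap_above (2 * r)
      (r + a r + 2 * r * \sum_(r.+1 <= t < k) size (component T t))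
      (component T r) = gap_above (2 * r)
      (r + (a r + 2 * minn r j)
        + 2 * r * \sum_(r.+1 <= t < k) size (component T' t))
      (component T' r).
    move=> rk nrj; have [rj|rj|] := ltngtP r j; last by lia.
      rewrite eq_lt; last by lia.
      congr gap_above.
      have -> : \sum_(r.+1 <= t < k) size (component T t) =
          (\sum_(r.+1 <= t < k) size (component T' t)).+1.
        rewrite (@eq_big_nat _ _ _ r.+1 k _
          (fun t => size (component T' t) + (t == j))); last first.
          by move=> t tk; rewrite szE //; lia.
        rewrite big_split /= -[RHS]addn1; congr (_ + _).
        rewrite (bigD1_seq j) ?iota_uniq ?mem_index_iota ?eqxx /=; try lia.
        by rewrite big1 // => t /negPf->.
      by nia.
    rewrite eq_gt; last by lia.
    rewrite -(gap_above_map _ _ (2 * j)); congr gap_above.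
    rewrite (@eq_big_nat _ _ _ r.+1 k _ (fun t => size (component T' t))); first lia.
    by move=> t tk; rewrite szE ?gtn_eqF ?addn0 //; lia.
  rewrite /predD /=; apply/idP/and3P.
    case/andP=> _ /shifted_tupleP[_ gapT nT mT]; split; [lia|lia|].
    apply/shifted_tupleP; split=> //; [|lia|lia].
    move=> r rk; have [->|nrj] := eqVneq r j; last by rewrite -gapE //; exact: gapT.
    (* For [r = j] the remaining parts lie at least [2 * j] above the removed one, which is the
       increase of the shift. *)
    move: (gapT j jk); rewrite eq_j gap_above_rcons minnn -/(above T').
    by move=> /andP[_]; congr gap_above; lia.
  case=> le_n le_m /shifted_tupleP[_ gapT nT mT]; apply/andP; split.
    apply/negP=> /shifted_tupleP[_ /(_ j jk) + _ _].
    rewrite eq_j gap_above_rcons -/(above T) aboveE eqxx.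
    by move=> /andP[]; lia.
  apply/shifted_tupleP; split=> //; [|lia|lia].
  move=> r rk; have [->|nrj] := eqVneq r j; last by rewrite gapE //; exact: gapT.
  rewrite eq_j gap_above_rcons -/(above T) aboveE leqnn /=.
  move: (gapT j jk); rewrite minnn -/(above T').
  by congr gap_above; lia.
- exact: counts_shifted.
- exact: counts_shifted.
- case: ifP => [/andP[le_n le_m]|h].
    by rewrite /R le_n le_m; exact: counts_shifted.
  by exists [::]; split=> // T; rewrite in_nil /R andbA h.
Qed.

(** * Telescoping sums and the Rogers-Selberg recursion for [G] *)

(** On coefficients, multiplication of a generating function by [x^j q^c]. *)
Definition shift (c j : nat) (f : nat -> nat -> nat) (n m : nat) : nat :=
  if (c <= n) && (j <= m) then f (n - c) (m - j) else 0.

Lemma shift_add (c d j e : nat) (f : nat -> nat -> nat) (n m : nat) :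
  shift (c + d) (j + e) f (n + d) (m + e) = shift c j f n m.
Proof. by rewrite /shift !leq_add2r !subnDr. Qed.

Lemma eq_shift (c c' j j' : nat) (f g : nat -> nat -> nat) (n m : nat) :
  c = c' -> j = j' -> (forall n m, f n m = g n m) ->
  shift c j f n m = shift c' j' g n m.
Proof. by move=> -> -> fg; rewrite /shift fg. Qed.

(** Apply [shifted_count_rec] at [lo], then [lo + 1], and so on: when [j] is raised, exactly the
    coordinates in [[lo, j)] have been raised before. *)
Lemma telescope_up (k : nat) (a : nat -> nat) (lo hi n m : nat) :
  1 <= lo <= hi -> hi <= k ->
  shifted_count k a n m = shifted_count k (fun r => a r + (lo <= r < hi)) n m +
    \sum_(lo <= j < hi)
      shift (j + a j) j
        (shifted_count k (fun r => a r + (lo <= r < j) + 2 * minn r j)) n m.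
Proof.
case/andP=> lo_gt0; elim: hi => [|hi IHhi]; first by lia.
rewrite leq_eqVlt => /orP[/eqP<- _|le_lo le_hi].
  rewrite big_geq // addn0; apply: eq_shifted_count => r _; lia.
rewrite IHhi; [|lia|lia]; rewrite big_nat_recr /=; last by lia.
rewrite (@shifted_count_rec _ _ hi); last by lia.
rewrite ltnn andbF addn0 -addnA; congr (_ + _); last exact: addnC.
by apply: eq_shifted_count => r _; lia.
Qed.

(** The same in the opposite order: when [j] is raised, the coordinates strictly between [j] and
    [hi] have been raised before. *)
Lemma telescope_down (k : nat) (a : nat -> nat) (lo hi n m : nat) :
  1 <= lo <= hi -> hi <= k ->
  shifted_count k a n m = shifted_count k (fun r => a r + (lo <= r < hi)) n m +
    \sum_(lo <= j < hi)
      shift (j + a j) j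
        (shifted_count k (fun r => a r + (j < r < hi) + 2 * minn r j)) n m.
Proof.
case/andP=> + le_lo le_hi; have [d] := ubnP (hi - lo).
elim: d lo le_lo => // d IHd lo; rewrite leq_eqVlt.
case/orP=> [/eqP<- _ _|lt_lo lt_d lo_gt0].
  rewrite big_geq // addn0; apply: eq_shifted_count => r _; lia.
rewrite (IHd lo.+1); [|lia|lia|lia]; rewrite [in RHS]big_ltn //.
rewrite (@shifted_count_rec _ _ lo); last by lia.
rewrite ltnn /= addn0 -addnA; congr (_ + _).
by apply: eq_shifted_count => r _; lia.
Qed.

(* The coefficient of [x^m q^n] in [\sum_(p <= j <= s) (x q^2)^(j - p) S_(v_j)],
   where [v_j] is the shift below. *)
Definition Phi (k s p n m : nat) : nat :=
  \sum_(p <= j < s.+1) shift (2 * (j - p)) (j - p)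
    (shifted_count k (fun r =>
       2 * r + minn r j.-1 + minn r j - minn r s - minn r p.-1)) n m.

(* Both sides arise, up to the factor [(x q)^p], by raising the coordinates
   [p, ..., s] of [2r - min(r,s) - min(r,p)] one at a time, in increasing and in
   decreasing order. *)
Lemma Phi_succ (k s p n m : nat) :
  1 <= p <= s -> s < k -> Phi k s p n m = Phi k s.+1 p.+1 n m.
Proof.
move=> ps sk; pose a r := 2 * r - minn r s - minn r p.
have ps1 : 1 <= p <= s.+1 by lia.
(* The arguments [n + p] and [m + p] absorb the factor [(x q)^p]. *)
have up := telescope_up a (n + p) (m + p) ps1 sk.
have := telescope_down a (n + p) (m + p) ps1 sk.
(* Both orders end at the same fully raised shift, so these leading terms cancel. *)
rewrite up => /addnI eq_sum; rewrite /Phi big_add1 /=.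
transitivity (\sum_(p <= j < s.+1) shift (j + a j) j
    (shifted_count k (fun r => a r + (p <= r < j) + 2 * minn r j))
    (n + p) (m + p)).
  apply: eq_big_nat => j js; rewrite -(shift_add _ p _ p).
  apply: eq_shift; rewrite /a; [lia|lia|] => n' m'.
  by apply: eq_shifted_count => r rk; lia.
rewrite {}eq_sum; apply: eq_big_nat => j js; rewrite -[RHS](shift_add _ p _ p).
apply: eq_shift; rewrite /a; [lia|lia|] => n' m'.
by apply: eq_shifted_count => r rk; lia.
Qed.

(** The sum [Phi k s 1] is the descending expansion of the right side over the coordinates
    [1, ..., s - 1]: its term [j = 1] is the fully raised count, the others are the corrections. *)
Lemma Phi_1 (k s n m : nat) :
  1 <= s <= k ->
  Phi k s 1 n m = shifted_count k (fun r => 2 * r - minn r s.-1) n m.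
Proof.
move=> sk; rewrite (@telescope_down k _ 1 s); [|lia|lia].
rewrite /Phi big_ltn; last by lia.
rewrite big_add1 /=; congr (_ + _).
  rewrite /shift /= !subn0; apply: eq_shifted_count => r rk; lia.
apply: eq_big_nat => j js; apply: eq_shift; [lia|lia|] => n' m'.
by apply: eq_shifted_count => r rk; lia.
Qed.

(** [Phi_succ] lowers [s] and [p] together, preserving [s - p], until [Phi_1] applies. *)
Lemma PhiE (k s p n m : nat) :
  1 <= p <= s -> s <= k ->
  Phi k s p n m = shifted_count k (fun r => 2 * r - minn r (s - p)) n m.
Proof.
case/andP; elim: p s => // p IHp [//|s] _; have [->|p_gt0] := posnP p.
  by move=> _ sk; rewrite Phi_1 //= subn1.
by move=> ps sk; rewrite -Phi_succ ?subSS ?IHp //; lia.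
Qed.

(** Raising the coordinates [s, ..., k - 1] of [r - s] gives [r + 1 - s], that is, passes from
    [i = s + 1] to [i = s]; the corrections add up to [(x q)^s] times [Phi k k.-1 s]. *)
Lemma shifted_count_rogers_selberg (k s n m : nat) :
  1 <= s < k ->
  shifted_count k (fun r => r - s) n m = shifted_count k (fun r => r.+1 - s) n m +
    shift s s (shifted_count k (fun r => 2 * r - minn r (k.-1 - s))) n m.
Proof.
move=> sk; rewrite (@telescope_up k _ s k); [|lia|lia].
congr (_ + _); first by apply: eq_shifted_count => r rk; lia.
transitivity (shift s s (Phi k k.-1 s) n m); last first.
  by apply: eq_shift => // n' m'; apply: PhiE; lia.
(* If [s] exceeds [n] or [m], all terms vanish, since both exponents [j + (j - s)] and [j] are at
   least [s]. *)
rewrite {2}/shift; case: ifP => [/andP[sn sm]|nsm]; last first.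
  rewrite big_nat big1 // => j js; rewrite /shift ifF //.
  by apply/negbTE; move/negbT: nsm; lia.
rewrite /Phi prednK; last by lia.
apply: eq_big_nat => j js; have sj : s <= j by lia.
rewrite -[RHS](shift_add _ s _ s) !subnK //.
apply: eq_shift; [lia|lia|] => n' m'.
by apply: eq_shifted_count => r rk; lia.
Qed.

(** The shift [2r - min(r, k - 1 - i)] is that of [G_(k,k-i)] translated by [r], which replaces [x]
    by [x q]. The case [i = 0] is set apart because [G_count k 0] still counts the empty tuple. *)
Lemma G_count_rec (k i n m : nat) :
  2 <= k -> i < k ->
  G_count k i.+1 n m =
  (if i == 0 then 0 else G_count k i n m) +
  if (m <= n) && (i <= m) then G_count k (k - i) (n - m) (m - i) else 0.
Proof.
move=> hk hi; rewrite !G_countE; have [->|i_gt0] := posnP i.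
  rewrite leq0n andbT !subn0 -shifted_count_translate.
  by apply: eq_shifted_count => r rk; lia.
rewrite shifted_count_rogers_selberg; last by lia.
congr (_ + _); rewrite /shift.
rewrite (@eq_shifted_count k _ (fun j => j.+1 - (k - i) + j));
  last by move=> r; lia.
rewrite shifted_count_translate.
case: (leqP i m) => im; rewrite ?andbF // !andbT.
case: (leqP i n) => i_n; last by rewrite ifF //; lia.
by rewrite leq_sub2rE // subnBA // subnK.
Qed.

(** * Initial values and the final induction *)

Lemma F_count_0 (k i n : nat) :
  2 <= k -> 1 <= i <= k -> F_count k i n 0 = (n == 0).
Proof.
move=> hk hi; apply: counts_unique (counts_F k i n 0) _.
exists (nseq (n == 0) [::]); split; rewrite ?size_nseq //; first by case: eqP.
move=> p; apply/nseqP/idP => [[-> n0]|].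
  by apply/F_partition_freq => //; split=> //=; lia.
by case/F_partition_freq => // _ /size0nil -> /= <-.
Qed.

Lemma G_count_0 (k i n : nat) :
  2 <= k -> 1 <= i <= k -> G_count k i n 0 = (n == 0).
Proof.
move=> hk hi; rewrite G_countE; apply: counts_unique (counts_shifted k _ n 0) _.
exists (nseq (n == 0) (nseq k.-1 [::])); split; rewrite ?size_nseq //.
  by case: eqP.
have comp0 j : component (nseq k.-1 [::]) j = [::].
  by rewrite /component nth_nseq if_same.
move=> T; apply/nseqP/shifted_tupleP => [[-> n0]|[sT _ nT mT]].
  split=> [|j _||]; rewrite ?size_nseq ?comp0 //.
    by rewrite big1 => [|j _]; [lia | rewrite comp0].
  by rewrite big1 // => j _; rewrite comp0 muln0.
have T0 j : 1 <= j < k -> component T j = [::].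
  move=> jk; apply/eqP; rewrite -size_eq0.
  move/eqP: mT; rewrite sum_nat_seq_eq0 => /allP/(_ j).
  by rewrite mem_index_iota jk muln_eq0 => /(_ isT) /=; case: j jk.
split; last by rewrite -nT big_nat big1 // => j jk; rewrite T0.
apply: (@eq_components k); rewrite ?size_nseq // => j jk.
by rewrite T0 // comp0.
Qed.

Theorem theorem1 (k i : nat) (hk : 2 <= k) (hi : 1 <= i <= k) (n m : nat) :
  F_count k i n m = G_count k i n m.
Proof.
(* Induction on [n]: for [m > 0] the last term of the recursion has weight [n - m < n], whereas
   [m - i] need not drop when [i = 0]. The first term is handled by an inner induction on [i]. *)
have [N] := ubnP n; elim: N n m i hi => // N IHN n m i hi lt_n.
have [->|m_gt0] := posnP m; first by rewrite F_count_0 ?G_count_0.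
case: i hi => // i; elim: i => [|i IHi] hi.
- rewrite F_count_rec // G_count_rec // (_ : F_count k 0 n m = 0); last first.
    apply: counts_unique (counts_F k 0 n m) _; exists [::]; split=> // p.
    by rewrite F_partition0.
  by rewrite !add0n; case: ifP => // mn; apply: IHN; lia.
- have hik : i.+1 < k by case/andP: hi.
  rewrite F_count_rec // G_count_rec //; congr (_ + _); first by apply: IHi; lia.
  by case: ifP => // mn; apply: IHN; lia.
Qed.
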